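(* Suppose $\mu^0/\nu^0$ and $\mu^1/\nu^1$ are skew shapes whose skew diagrams have identical connected components. Let $N=|\mu^0/\nu^0|=|\mu^1/\nu^1|$ and $\theta\vdash N$. Then $\Gamma^\theta_{\mu^0/\nu^0}=\Gamma^\theta_{\mu^1/\nu^1}$ (as functions on the same symmetric group $S_n$).
   Context: Partitions are weakly decreasing sequences of positive integers, extended by zeros when needed ($\nu$ may be empty). A skew shape $\mu/\nu$ is a pair of partitions with $\nu_i\le\mu_i$ for all $i$; its diagram is the Young diagram of $\mu$ with the boxes of $\nu$ removed; its length $\ell(\mu/\nu)$ is the largest $i$ with $\nu_i<\mu_i$, and $|\mu/\nu|=\sum_i(\mu_i-\nu_i)$. Connected components of a diagram are taken with respect to boxes sharing an edge (nonempty consecutive rows $i,i+1$ lie in the same component iff $\mu_{i+1}>\nu_i$). Two diagrams have identical connected components if their components, each considered up to translation, agree as multisets (i.e. one is obtained from the other by changing the order and position of the components). For $\theta\vdash N$ and an integer sequence $c=(c_1,\ldots,c_n)$ summing to $N$, the Kostka number $K_{\theta,c}$ is the number of semistandard Young tableaux of shape $\theta$ with content $c$; it is $0$ if some $c_i<0$. Fix $n$ at least the lengths of both shapes. For a skew shape $\mu/\nu$ with $\ell(\mu/\nu)\le n$, let $\delta=(n-1,\ldots,1,0)$, regard $\mu,\nu$ as their first $n$ entries, and let $w\in S_n$ act by $w(a_1,\ldots,a_n)=(a_{w^{-1}(1)},\ldots,a_{w^{-1}(n)})$. For $\theta\vdash N=|\mu/\nu|$ the immanant character $\Gamma^\theta_{\mu/\nu}:S_n\to\mathbb{Z}$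 is $$\Gamma^\theta_{\mu/\nu}(w)=\frac{n!}{|C(w)|}\sum_{w'\in C(w)}K_{\theta,\ \mu+\delta-w'(\nu+\delta)},$$ where $C(w)$ is the conjugacy class of $w$ in $S_n$. *)

(* Defs.v *)
From HB Require Import structures.
From mathcomp Require Import all_boot all_order all_algebra all_fingroup.

Set Implicit Arguments.
Unset Strict Implicit.
Unset Printing Implicit Defensive.

Import Order.TTheory GRing.Theory Num.Theory.
Local Open Scope ring_scope.

Definition is_partition (s : seq nat) : bool :=
  sorted geq s && (0%N \notin s).

(* Rows and columns are numbered from 0: [part s i] is the usual
   s_{i+1}, and it is 0 past the last part. *)
Definition part (s : seq nat) (i : nat) : nat := nth 0%N s i.

Definition is_skew_shape (mu nu : seq nat) : Prop :=
  [/\ is_partition mu, is_partition nu & forall i, (part nu i <= part mu i)%N].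

(* With rows numbered from 1, the largest i such that nu_i < mu_i; it is 0 if
   there is none. *)
Definition skew_length (mu nu : seq nat) : nat :=
  \max_(i < size mu | (part nu i < part mu i)%N) i.+1.

Definition skew_size (mu nu : seq nat) : nat :=
  (\sum_(i < size mu) (part mu i - part nu i))%N.

(* A box is a pair (row, column); coordinates are taken in int so that diagrams
   can be translated in every direction. *)
Definition boxes (mu nu : seq nat) : seq (int * int) :=
  [seq (i%:Z, j%:Z) | i <- iota 0 (size mu),
                      j <- iota (part nu i) (part mu i - part nu i)].

Definition box (mu nu : seq nat) : finType := seq_sub (boxes mu nu).

(* Unit squares share an edge iff their positions are at l1-distance 1. *)
Definition box_adj (mu nu : seq nat) : rel (box mu nu) :=
  fun b b' =>
    `|(val b).1 - (val b').1| + `|(val b).2 - (val b').2| == 1 :> int.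

Definition components (mu nu : seq nat) : {set {set box mu nu}} :=
  equivalence_partition (connect (@box_adj mu nu)) [set: box mu nu].

Definition is_translate (mu nu mu' nu' : seq nat)
    (C : {set box mu nu}) (C' : {set box mu' nu'}) : Prop :=
  exists d : int * int,
    [seq val b + d | b in C] =i [seq val b | b in C'].

(* Equality of the multisets of translation classes of components: a bijection
   between the two sets of components that matches translates. *)
Definition identical_components (mu0 nu0 mu1 nu1 : seq nat) : Prop :=
  exists f : {set box mu0 nu0} -> {set box mu1 nu1},
    [/\ {in components mu0 nu0 &, injective f},
        f @: components mu0 nu0 = components mu1 nu1
      & forall C, C \in components mu0 nu0 -> is_translate C (f C)].

Definition is_ssyt (n : nat) (theta : seq nat)
    (t : {ffun box theta [::] -> 'I_n}) : bool :=
  [forall b, forall b',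
     (((val b).1 == (val b').1) && ((val b).2 <= (val b').2) ==> (t b <= t b')%N)
  && (((val b).2 == (val b').2) && ((val b).1 < (val b').1) ==> (t b < t b')%N)].

(* Entries are 0, ..., n-1. The count is 0 as soon as some [c k] is negative. *)
Definition kostka (n : nat) (theta : seq nat) (c : 'I_n -> int) : nat :=
  #|[set t : {ffun box theta [::] -> 'I_n} |
      is_ssyt t && [forall k, #|[set b | t b == k]|%:Z == c k]]|.

(* The first n entries of s + delta, with delta = (n-1, ..., 1, 0). *)
Definition add_delta (n : nat) (s : seq nat) (i : 'I_n) : int :=
  (part s i + (n.-1 - i))%N%:Z.

Definition perm_act (n : nat) (w : 'S_n) (a : 'I_n -> int) (i : 'I_n) : int :=
  a ((w^-1)%g i).

(* The quotient n! / #|C(w)| is exact: it is the order of the centraliser of w. *)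
Definition immanant_character (n : nat) (theta mu nu : seq nat) (w : 'S_n) : int :=
  (n`! %/ #|(w ^: [set: 'S_n])%g|)%N%:Z *
  \sum_(w' in (w ^: [set: 'S_n])%g)
     (kostka theta
        (fun i => add_delta mu i - perm_act w' (@add_delta n nu) i))%:Z.

(* Main.v *)
Require Import Defs.
From mathcomp Require Import all_boot all_order all_algebra all_fingroup.
From mathcomp Require Import zify.

Set Implicit Arguments.
Unset Strict Implicit.
Unset Printing Implicit Defensive.

Import Order.TTheory GRing.Theory Num.Theory.
Local Open Scope ring_scope.

(** The content in the term of [w] of the immanant character has the entries
    [M i (w^-1 i)], where [M i j = (mu + delta)_i - (nu + delta)_j] is the
    matrix of degrees of the Jacobi-Trudi determinant of the skew shape
    ([jt_exp]). The proof uses three facts about [M] and the Kostka numbers.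

    First, [M] is block triangular, with one block for each connected component
    and one block of size one for each empty row: if rows [k] and [k.+1] do not
    overlap, then [M i j < 0] whenever [j <= k < i]. A Kostka number with a
    negative entry in its content vanishes, and a permutation that never moves
    an index across a gap in one direction does not move any across it in the
    other. So only the [w] that preserve every block contribute
    ([jt_exp_ge0_linked]).

    Secondly, the entries of [M] in a diagonal block do not change when the
    component is translated. Both shapes have the same number of empty rows
    among the first [n], and the diagonal entry of an empty row is [0]. Hence a
    permutation [s] of the indices carries the diagonal blocks of one matrix to
    those of the other ([row_matching]).

    Thirdly, Kostka numbers are symmetric in the content ([kostka_perm]), so the
    term of [w] for the first shape equals the term of [w ^ s] for the second.
    Conjugation by [s] permutes each conjugacy class, and the two sums agree.

    The symmetry of Kostka numbers is proved with the Bender-Knuth involution in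
    its Gelfand-Tsetlin form: a tableau is recorded by the numbers of entries
    below [m] in each row, semistandardness means that these numbers interlace
    ([ssyt_of_pattern]), and the involution reflects the numbers for one level
    [m] in the intervals allowed by the adjacent levels. *)

(** * Boxes of a skew diagram *)

Lemma part_anti s i j : is_partition s -> (i <= j)%N ->
  (part s j <= part s i)%N.
Proof.
case/andP=> srt _ leij; rewrite /part.
case: (ltnP j (size s)) => [ltj|lej]; last by rewrite (nth_default _ lej).
have trG : transitive geq by move=> x y z /= h1 h2; apply: leq_trans h2 h1.
exact: (sorted_leq_nth trG leqnn 0%N srt i j (leq_ltn_trans leij ltj) ltj leij).
Qed.

Lemma part_nil i : part [::] i = 0%N.
Proof. exact: nth_nil. Qed.

Definition brow mu nu (b : box mu nu) : nat := `|(val b).1|%N.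
Definition bcol mu nu (b : box mu nu) : nat := `|(val b).2|%N.

Lemma mem_boxes mu nu (x : int * int) :
  x \in boxes mu nu ->
  [/\ x = (`|x.1|%N%:Z, `|x.2|%N%:Z), (`|x.1| < size mu)%N
    & (part nu `|x.1| <= `|x.2| < part mu `|x.1|)%N].
Proof.
case/allpairsPdep=> i [j] [+ + ->] /=.
by rewrite !mem_iota => hi hj; split=> //; lia.
Qed.

Lemma box_val mu nu (b : box mu nu) : val b = ((brow b)%:Z, (bcol b)%:Z).
Proof. by case: (mem_boxes (valP b)). Qed.

Lemma box_in mu nu (b : box mu nu) :
  (part nu (brow b) <= bcol b < part mu (brow b))%N.
Proof. by case: (mem_boxes (valP b)). Qed.

Lemma brow_lt mu nu (b : box mu nu) : (brow b < size mu)%N.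
Proof. by case: (mem_boxes (valP b)). Qed.

Lemma box_exists mu nu i j : (part nu i <= j < part mu i)%N ->
  exists2 b : box mu nu, brow b = i & bcol b = j.
Proof.
move=> hj; have hi : (i < size mu)%N.
  by rewrite ltnNge; apply/negP => le; move: hj; rewrite /part (nth_default _ le); lia.
have hb : (i%:Z, j%:Z) \in boxes mu nu.
  by apply/allpairsPdep; exists i, j; rewrite !mem_iota; split=> //; lia.
by exists (SeqSub hb).
Qed.

Lemma box_eq mu nu (b b' : box mu nu) :
  brow b = brow b' -> bcol b = bcol b' -> b = b'.
Proof. by move=> h1 h2; apply: val_inj; rewrite !box_val h1 h2. Qed.

Lemma nonempty_row mu nu i :
  reflect (exists b : box mu nu, brow b = i) (part nu i < part mu i)%N.
Proof.
apply: (iffP idP) => [lt|[b <-]].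
  have [b rb _] : exists2 b : box mu nu, brow b = i & bcol b = part nu i.
    by apply: box_exists; rewrite leqnn.
  by exists b.
by case/andP: (box_in b); apply: leq_ltn_trans.
Qed.

Lemma brow_lt_skew_length mu nu (b : box mu nu) :
  (brow b < skew_length mu nu)%N.
Proof.
have := box_in b => /andP[h1 h2].
apply: (@leq_bigmax_cond _ (fun i : 'I_(size mu) => part nu i < part mu i)%N
  (fun i : 'I_(size mu) => i.+1) (Ordinal (brow_lt b))).
exact: leq_ltn_trans h1 h2.
Qed.

(** * Symmetry of Kostka numbers *)

Section Tableaux.

Variables (n : nat) (theta : seq nat).
Hypothesis theta_part : is_partition theta.
Local Notation tbox := (box theta [::]).
Implicit Types (t : {ffun tbox -> 'I_n}) (b : tbox).

Lemma ssytP t :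
  reflect
    (forall b b',
       (brow b = brow b' -> (bcol b <= bcol b')%N -> (t b <= t b')%N) /\
       (bcol b = bcol b' -> (brow b < brow b')%N -> (t b < t b')%N))
    (is_ssyt t).
Proof.
apply: (iffP forallP) => [h b b'|h b].
  have := forallP (h b) b'; rewrite !box_val /= => /andP[/implyP h1 /implyP h2].
  by split=> e l; [apply: h1|apply: h2]; rewrite e eqxx.
apply/forallP => b'; rewrite !box_val /=; have [h1 h2] := h b b'.
by apply/andP; split; apply/implyP => /andP[/eqP[e] l]; [apply: h1|apply: h2].
Qed.

Definition rowcount t m i : nat := #|[set b | (brow b == i) && (t b < m)%N]|.

Lemma tcol_lt b : (bcol b < part theta (brow b))%N.
Proof. by case/andP: (box_in b). Qed.

Lemma tbox_exists i j : (j < part theta i)%N ->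
  exists2 b : tbox, brow b = i & bcol b = j.
Proof. by move=> h; apply: box_exists; rewrite part_nil. Qed.

Lemma card_row_prefix i l : (l <= part theta i)%N ->
  #|[set b : tbox | (brow b == i) && (bcol b < l)%N]| = l.
Proof.
elim: l => [|l IH] hl.
  by apply/eqP; rewrite cards_eq0; apply/eqP/setP => b; rewrite !inE ltn0 andbF.
have [b0 r0 c0] := tbox_exists hl.
rewrite (_ : [set b | _] = b0 |: [set b : tbox | (brow b == i) && (bcol b < l)%N]).
  by rewrite cardsU1 IH ?(ltnW hl) // inE c0 ltnn andbF.
apply/setP => b; rewrite !inE ltnS leq_eqVlt; apply/idP/idP; last first.
  by case/orP=> [/eqP->|/andP[-> ->]]; rewrite ?r0 ?c0 ?eqxx ?orbT.
case/andP=> /eqP e /orP[/eqP e'|->]; last by rewrite e eqxx orbT.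
by rewrite (@box_eq _ _ b b0) ?eqxx ?r0 ?c0.
Qed.

Lemma rowcount_le t m i : (rowcount t m i <= part theta i)%N.
Proof.
rewrite -[leqRHS](card_row_prefix (leqnn (part theta i))).
apply: subset_leq_card; apply/subsetP => b; rewrite !inE.
by case/andP=> /eqP <- _; rewrite eqxx tcol_lt.
Qed.

Lemma rowcount_mono t m m' i : (m <= m')%N ->
  (rowcount t m i <= rowcount t m' i)%N.
Proof.
move=> le; apply: subset_leq_card; apply/subsetP => b; rewrite !inE.
by case/andP=> -> h; apply: leq_trans h le.
Qed.

(** Entries increase weakly along a row, so those below [m] occupy an initial
    segment of it. *)
Lemma ssyt_lt_rowcount t m b : is_ssyt t ->
  (t b < m)%N = (bcol b < rowcount t m (brow b))%N.
Proof.
move/ssytP=> st; have hb := tcol_lt b.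
case: ltnP => h; symmetry.
  rewrite -[leqLHS](card_row_prefix hb).
  apply: subset_leq_card; apply/subsetP => b'; rewrite !inE ltnS.
  case/andP=> /eqP e le; rewrite e eqxx /=.
  by case: (st b' b) => /(_ e le) h' _; apply: leq_ltn_trans h' h.
apply/negbTE; rewrite -leqNgt -[leqRHS](card_row_prefix (ltnW hb)).
apply: subset_leq_card; apply/subsetP => b'; rewrite !inE.
case/andP=> /eqP e lt; rewrite e eqxx /= ltnNge; apply/negP => le.
by case: (st b b') => /(_ (esym e) le) h' _; lia.
Qed.

(** Successive row counts interlace: an entry of row [i.+1] that is at most [m]
    lies under an entry of row [i] that is less than [m]. *)
Lemma ssyt_interlace t m i : is_ssyt t ->
  (rowcount t m.+1 i.+1 <= rowcount t m i)%N.
Proof.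
move=> st; case E: (rowcount t m.+1 i.+1) => [//|j].
have hj1 : (j < part theta i.+1)%N by rewrite -E rowcount_le.
have hj : (j < part theta i)%N by apply: leq_trans hj1 (part_anti theta_part _).
have [b r c] := tbox_exists hj1; have [b' r' c'] := tbox_exists hj.
have := ssyt_lt_rowcount m.+1 b st; rewrite r c E ltnSn ltnS => h.
have := ssyt_lt_rowcount m b' st; rewrite r' c' => <-.
by case/ssytP/(_ b' b): st => _; rewrite r r' c c' => /(_ erefl (ltnSn _)); lia.
Qed.

(** A converse to the two previous lemmas: a filling is semistandard as soon as
    its sublevel sets are row prefixes of interlacing lengths, that is, as soon
    as it is given by a Gelfand-Tsetlin pattern [l]. *)
Lemma ssyt_of_pattern t (l : nat -> nat -> nat) :
  (forall m b, (t b < m)%N = (bcol b < l m (brow b))%N) ->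
  (forall m i, l m.+1 i.+1 <= l m i)%N ->
  (forall m i, l m i <= l m.+1 i)%N -> is_ssyt t.
Proof.
move=> tl inter mono; apply/ssytP => b b'; split=> [e le|e lt].
  by rewrite -ltnS tl e; apply: leq_ltn_trans le _; rewrite -tl.
have step d i m : (l m.+1 (i + d.+1) <= l m i)%N.
  elim: d => [|d IH]; first by rewrite addn1.
  by rewrite addnS; apply: leq_trans (leq_trans (inter _ _) (mono _ _)) IH.
rewrite tl e; have := leqnn (t b').+1; rewrite tl => h.
by apply: leq_trans h _; rewrite -(subnKC lt) addSnnS.
Qed.

Lemma ssyt_eq t1 t2 : is_ssyt t1 -> is_ssyt t2 ->
  (forall m i, rowcount t1 m i = rowcount t2 m i) -> t1 = t2.
Proof.
move=> s1 s2 e; apply/ffunP => b; apply/val_inj/eqP => /=.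
have h m : (t1 b < m)%N = (t2 b < m)%N by rewrite !ssyt_lt_rowcount // e.
by rewrite eqn_leq -ltnS h ltnSn -ltnS -h ltnSn.
Qed.

Lemma card_sublevel t m :
  #|[set b | (t b < m)%N]| = (\sum_(i < size theta) rowcount t m i)%N.
Proof.
rewrite -sum1dep_card
  (partition_big (fun b => Ordinal (brow_lt b)) xpredT) //=.
apply: eq_bigr => i _; rewrite sum1dep_card; apply: eq_card => b.
by rewrite !inE andbC.
Qed.

Lemma card_level t (k : 'I_n) :
  (#|[set b | (t b < k.+1)%N]| =
   #|[set b | (t b < k)%N]| + #|[set b | t b == k]|)%N.
Proof.
rewrite -cardsUI (_ : _ :&: _ = set0); last first.
  by apply/setP => b; rewrite !inE; case: eqP => [->|]; rewrite ?ltnn ?andbF.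
rewrite cards0 addn0; apply: eq_card => b.
by rewrite !inE ltnS leq_eqVlt orbC -val_eqE.
Qed.

(** The number of entries at most [k] in row [i] of the Bender-Knuth image.
    With the row counts for [k] and [k.+2] given, the one for [k.+1] ranges
    over the interval from [maxn _ _] to [minn _ _]; it is reflected in the
    midpoint of this interval. *)
Definition bk_min t k i : nat :=
  minn (rowcount t k.+2 i)
       (if i is i'.+1 then rowcount t k i' else rowcount t k.+2 i).

Definition bk_max t k i : nat := maxn (rowcount t k i) (rowcount t k.+2 i.+1).

Definition bk_count t k i : nat :=
  (bk_max t k i + bk_min t k i - rowcount t k.+1 i)%N.

Definition bk_entry (k1 k2 : 'I_n) t : {ffun tbox -> 'I_n} :=
  [ffun b => if (k1 <= t b <= k2)%N
             then if (bcol b < bk_count t k1 (brow b))%N then k1 else k2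
             else t b].

Lemma bk_range t k i : is_ssyt t ->
  (bk_max t k i <= rowcount t k.+1 i <= bk_min t k i)%N.
Proof.
move=> st; rewrite geq_max leq_min !rowcount_mono // ssyt_interlace //=.
by case: i => [|i]; rewrite ?rowcount_mono // ssyt_interlace.
Qed.

Lemma bk_count_range t k i : is_ssyt t ->
  (bk_max t k i <= bk_count t k i <= bk_min t k i)%N.
Proof. by move=> st; have := bk_range k i st; rewrite /bk_count; lia. Qed.

Lemma rowcount_bk_count t k i : is_ssyt t ->
  (rowcount t k i <= bk_count t k i <= rowcount t k.+2 i)%N.
Proof.
move=> st; have := bk_count_range k i st; rewrite geq_max leq_min.
by case/andP=> /andP[-> _] /andP[-> _].
Qed.

Section BenderKnuth.

Variables (k1 k2 : 'I_n).
Hypothesis k12 : k2 = k1.+1 :> nat.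
Local Notation bk := (bk_entry k1 k2).

(** The Gelfand-Tsetlin pattern of [bk t]. *)
Let pattern t (m i : nat) : nat :=
  if m == k1.+1 then bk_count t k1 i else rowcount t m i.

Lemma bkE t b : bk t b = (if (k1 <= t b < k1.+2)%N
  then if (bcol b < bk_count t k1 (brow b))%N then k1 : nat else k1.+1
  else t b) :> nat.
Proof.
by rewrite ffunE k12 !ltnS; case: ifP => // _; case: ifP => // _; rewrite k12.
Qed.

Lemma bk_pattern t m b : is_ssyt t ->
  (bk t b < m)%N = (bcol b < pattern t m (brow b))%N.
Proof.
move=> st; rewrite /pattern bkE.
have /andP[lo hi] := rowcount_bk_count k1 (brow b) st.
have := ssyt_lt_rowcount k1 b st; have := ssyt_lt_rowcount k1.+2 b st.
have := ssyt_lt_rowcount m b st.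
move: (t b : nat) => v.
case: eqP => [->|ne] hm h2 h0; last first.
  by rewrite -hm; case: ifP => // hv; case: ifP => _; lia.
by case: ifP => hv; [case: ifP|]; lia.
Qed.

Lemma bk_ssyt t : is_ssyt t -> is_ssyt (bk t).
Proof.
move=> st; apply: (@ssyt_of_pattern _ (pattern t)) => [m b|m i|m i].
- exact: bk_pattern.
- rewrite /pattern eqSS; case: eqP => [->|_].
    rewrite (ltn_eqF (ltnSn _)).
    by have := bk_count_range k1 i.+1 st; rewrite /bk_min leq_min => /and3P[].
  case: eqP => [->|_]; last exact: ssyt_interlace.
  by have := bk_count_range k1 i st; rewrite /bk_max geq_max => /andP[/andP[]].
have /andP[lo hi] := rowcount_bk_count k1 i st.
rewrite /pattern eqSS; case: eqP => [->|_].
  by case: eqP => // _; apply: leq_trans lo hi.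
by case: eqP => [->|_] //; rewrite ?rowcount_mono.
Qed.

Lemma rowcount_bk t m i : is_ssyt t -> rowcount (bk t) m i = pattern t m i.
Proof.
move=> st; rewrite -[RHS](@card_row_prefix i).
  rewrite /rowcount; apply: eq_card => b; rewrite !inE bk_pattern //.
  by case: eqP => [->|].
rewrite /pattern; case: ifP => _; last exact: rowcount_le.
have := bk_range k1 i st; have := rowcount_le t k1.+2 i.
by rewrite /bk_count /bk_max /bk_min; lia.
Qed.

Lemma bkK t : is_ssyt t -> bk (bk t) = t.
Proof.
move=> st; have st' := bk_ssyt st.
apply: ssyt_eq; rewrite ?bk_ssyt // => m i.
rewrite !rowcount_bk // /pattern; case: eqP => [->|ne].
  have -> : bk_count (bk t) k1 i =
            (bk_max t k1 i + bk_min t k1 i - bk_count t k1 i)%N.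
    rewrite {1}/bk_count /bk_max /bk_min !rowcount_bk // /pattern eqxx.
    rewrite !(gtn_eqF (ltnSn _)) !(ltn_eqF (ltnSn _)).
    by case: i => [|i] //; rewrite !rowcount_bk // /pattern (ltn_eqF (ltnSn _)).
  by have := bk_range k1 i st; rewrite /bk_count; lia.
by rewrite rowcount_bk // /pattern; case: eqP.
Qed.

(** The midpoint reflections exchange the numbers of [k1] and [k2] because
    [maxn] in row [i] and [minn] in row [i.+1] have the same two arguments, so
    that the endpoints of all the intervals add up to the sum of the outer row
    counts. *)
Lemma card_sublevel_bk t : is_ssyt t ->
  (#|[set b | (bk t b < k1.+1)%N]| + #|[set b | (t b < k1.+1)%N]| =
   #|[set b | (t b < k1)%N]| + #|[set b | (t b < k1.+2)%N]|)%N.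
Proof.
move=> st; rewrite !card_sublevel -!big_split /=.
rewrite (eq_bigr (fun i : 'I__ => bk_max t k1 i + bk_min t k1 i)%N); last first.
  move=> i _; rewrite rowcount_bk // /pattern eqxx.
  by have := bk_range k1 i st; rewrite /bk_count; lia.
(* The last [bk_min] and row count are kept apart because row [s] pairs its
   [bk_max] with the [bk_min] of row [s.+1]; both vanish below the diagram. *)
have tele s : (\sum_(i < s) (bk_max t k1 i + bk_min t k1 i) + bk_min t k1 s =
   \sum_(i < s) (rowcount t k1 i + rowcount t k1.+2 i) + rowcount t k1.+2 s)%N.
  elim: s => [|s IH]; first by rewrite !big_ord0 !add0n /bk_min minnn.
  rewrite !big_ord_recr /=.
  have : (bk_max t k1 s + bk_min t k1 s.+1 =
          rowcount t k1 s + rowcount t k1.+2 s.+1)%N.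
    by rewrite /bk_max /bk_min; lia.
  move: IH; set A := (\sum_(i < s) _)%N; set B := (\sum_(i < s) _)%N.
  by lia.
have last0 : rowcount t k1.+2 (size theta) = 0%N.
  by apply/eqP; rewrite -leqn0 (leq_trans (rowcount_le _ _ _)) // /part nth_default.
by have := tele (size theta); rewrite /bk_min last0 min0n !addn0.
Qed.

Lemma card_sublevel_bk_other t m : is_ssyt t -> m != k1.+1 ->
  #|[set b | (bk t b < m)%N]| = #|[set b | (t b < m)%N]|.
Proof.
move=> st /negbTE ne; rewrite !card_sublevel; apply: eq_bigr => i _.
by rewrite rowcount_bk // /pattern ne.
Qed.

Lemma content_bk t k : is_ssyt t ->
  #|[set b | bk t b == k]| = #|[set b | t b == tperm k1 k2 k]|.
Proof.
move=> st; apply/eqP; rewrite -(eqn_add2l #|[set b | (bk t b < k)%N]|).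
rewrite -card_level; apply/eqP.
have e := card_sublevel_bk st; have e' m := @card_sublevel_bk_other t m st.
have c1 := card_level t k1; have c2 := card_level t k2.
case: tpermP => [->|->|/eqP ne1 /eqP ne2].
- by rewrite (e' k1) ?neq_ltn ?ltnSn //; move: c2; rewrite k12; lia.
- rewrite k12 (e' k1.+2) ?neq_ltn ?ltnSn ?orbT //.
  by move: c2; rewrite k12; lia.
have ck := card_level t k.
by rewrite !e' //; rewrite -?k12 // eqSS.
Qed.

End BenderKnuth.

Lemma kostka_ext (c c' : 'I_n -> int) : c =1 c' ->
  kostka theta c = kostka theta c'.
Proof.
move=> e; apply: eq_card => t; rewrite !inE; congr (_ && _).
by apply: eq_forallb => k; rewrite e.
Qed.

Lemma kostka_adjacent_le (k1 k2 : 'I_n) (c : 'I_n -> int) :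
  k2 = k1.+1 :> nat ->
  (kostka theta c <= kostka theta (c \o tperm k1 k2))%N.
Proof.
move=> k12; rewrite /kostka.
rewrite -(card_in_imset (f := bk_entry k1 k2)); last first.
  move=> t t'; rewrite !inE => /andP[st _] /andP[st' _] e.
  by rewrite -(bkK k12 st) e (bkK k12 st').
apply/subset_leq_card/subsetP => _ /imsetP[t + ->].
rewrite !inE => /andP[st /forallP h]; rewrite bk_ssyt //=.
by apply/forallP => k; rewrite content_bk.
Qed.

Lemma kostka_adjacent (k1 k2 : 'I_n) (c : 'I_n -> int) :
  k2 = k1.+1 :> nat ->
  kostka theta (c \o tperm k1 k2) = kostka theta c.
Proof.
move=> k12; apply/eqP; rewrite eqn_leq (kostka_adjacent_le c k12) andbT.
apply: leq_trans (kostka_adjacent_le _ k12) _.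
by rewrite (kostka_ext (c' := c)) // => k /=; rewrite tpermK.
Qed.

(** A transposition is conjugate to one of closer indices by an adjacent
    transposition. *)
Lemma kostka_tperm (i j : 'I_n) (c : 'I_n -> int) : (i < j)%N ->
  kostka theta (c \o tperm i j) = kostka theta c.
Proof.
move Ed: (j - i)%N => d; elim: d => [|d IH] in i j c Ed * => lt; first lia.
case: d => [|d] in IH Ed *; first by apply: kostka_adjacent; lia.
have hk : (i.+1 < n)%N by apply: leq_ltn_trans lt (ltn_ord j).
pose k := Ordinal hk.
have e : tperm i j = (tperm i k * tperm k j * tperm i k)%g.
  rewrite -{1}(tpermV i k) -mulgA -/(conjg _ _) tpermJ tpermR tpermD //.
    by rewrite -val_eqE /=; lia.
  by rewrite -val_eqE /=; lia.
have ik a : kostka theta (a \o tperm i k) = kostka theta a.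
  exact: kostka_adjacent.
have kj a : kostka theta (a \o tperm k j) = kostka theta a.
  by apply: IH => /=; lia.
by rewrite -[RHS]ik -[RHS]kj -[RHS]ik; apply: kostka_ext => x; rewrite e /= !permM.
Qed.

(** The symmetry of Schur polynomials: adjacent transpositions, the case given
    by the Bender-Knuth involution, generate the symmetric group. *)
Lemma kostka_perm (s : 'S_n) (c : 'I_n -> int) :
  kostka theta (c \o s) = kostka theta c.
Proof.
have [ts -> _] := prod_tpermP s.
elim: ts c => [|[i j] ts IH] c.
  by apply: kostka_ext => x; rewrite big_nil /= perm1.
have -> : kostka theta (c \o (\prod_(t <- (i, j) :: ts) tperm t.1 t.2)%g) =
  kostka theta ((c \o (\prod_(t <- ts) tperm t.1 t.2)%g) \o tperm i j).
  by apply: kostka_ext => x; rewrite big_cons /= permM.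
rewrite -[RHS]IH; case: (ltngtP i j) => [lt|gt|/val_inj ->].
- exact: kostka_tperm.
- by rewrite tpermC; apply: kostka_tperm.
by apply: kostka_ext => x; rewrite /= tperm1 perm1.
Qed.

Lemma kostka_neg (c : 'I_n -> int) k : c k < 0 -> kostka theta c = 0%N.
Proof.
move=> neg; apply/eqP; rewrite cards_eq0; apply/eqP/setP => t; rewrite !inE.
by apply/negbTE/negP => /andP[_ /forallP/(_ k)/eqP e]; lia.
Qed.

End Tableaux.

(** * Rows and connected components *)

Section Components.

Variables mu nu : seq nat.
Implicit Types b : box mu nu.
Local Notation linked := (connect (@box_adj mu nu)).

Lemma linkedC : connect_sym (@box_adj mu nu).
Proof.
apply: sym_connect_sym => b b'.
by rewrite /box_adj distrC [X in _ + X]distrC.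
Qed.

Lemma box_adjE b b' : box_adj b b' =
  (`|(brow b)%:Z - (brow b')%:Z| + `|(bcol b)%:Z - (bcol b')%:Z| == 1).
Proof. by rewrite /box_adj !box_val. Qed.

Lemma same_row_linked b b' : brow b = brow b' -> linked b b'.
Proof.
wlog le : b b' / (bcol b <= bcol b')%N => [hw|] e.
  by case/orP: (leq_total (bcol b) (bcol b')) => le; [|rewrite linkedC]; apply: hw.
move Ed: (bcol b' - bcol b)%N => d.
elim: d => [|d IH] in b' Ed le e *.
  by rewrite (@box_eq _ _ b b') ?connect0 //; lia.
have [c rc cc] : exists2 c : box mu nu, brow c = brow b & bcol c = (bcol b + d)%N.
  by apply: box_exists; have := box_in b; have := box_in b'; rewrite e; lia.
apply: connect_trans (IH c _ _ _) (connect1 _); try lia.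
by rewrite box_adjE rc cc e; lia.
Qed.

(** Overlapping rows [k] and [k.+1] both have a box in column [part nu k], and
    these two boxes share an edge. *)
Lemma overlap_linked b b' : is_skew_shape mu nu -> (brow b <= brow b')%N ->
  (forall k, brow b <= k < brow b' -> part nu k < part mu k.+1)%N ->
  linked b b'.
Proof.
case=> pmu pnu _; move Ed: (brow b' - brow b)%N => d.
elim: d => [|d IH] in b' Ed * => le ov.
  by apply: same_row_linked; lia.
have ovd : (part nu (brow b + d) < part mu (brow b + d).+1)%N by apply: ov; lia.
have a1 := part_anti pmu (leqnSn (brow b + d)).
have a2 := part_anti pnu (leqnSn (brow b + d)).
have [c rc cc] : exists2 c : box mu nu, brow c = (brow b + d)%N &
    bcol c = part nu (brow b + d).
  by apply: box_exists; lia.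
have [c' rc' cc'] : exists2 c : box mu nu, brow c = (brow b + d).+1%N &
    bcol c = part nu (brow b + d).
  by apply: box_exists; lia.
apply: (@connect_trans _ _ c); first by apply: IH => [||k hk]; try apply: ov; lia.
apply: (@connect_trans _ _ c'); last by apply: same_row_linked; lia.
by apply: connect1; rewrite box_adjE rc rc' cc cc'; lia.
Qed.

Definition comp b : {set box mu nu} := [set b' | linked b b'].

Lemma comp_refl b : b \in comp b.
Proof. by rewrite inE connect0. Qed.

Lemma comp_eq b b' : linked b b' -> comp b = comp b'.
Proof.
by move=> l; apply/setP => c; rewrite !inE (same_connect linkedC l).
Qed.

Lemma comp_in b : comp b \in components mu nu.
Proof.
by apply/imsetP; exists b => //; apply/setP => b'; rewrite !inE.
Qed.

Lemma componentsP C : C \in components mu nu -> exists b, C = comp b.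
Proof.
by case/imsetP=> b _ ->; exists b; apply/setP => b'; rewrite !inE.
Qed.

(** Empty rows are in relation with themselves only, so that they form blocks
    of their own. *)
Definition row_linked (i j : nat) : bool :=
  (i == j) || [exists b, exists b', [&& brow b == i, brow b' == j & linked b b']].

Lemma row_linkedP i j :
  reflect (i = j \/ exists b b', [/\ brow b = i, brow b' = j & linked b b'])
          (row_linked i j).
Proof.
apply: (iffP orP) => [[/eqP|/existsP[b /existsP[b' /and3P[/eqP h1 /eqP h2 h3]]]]|].
- by left.
- by right; exists b, b'.
case=> [->|[b [b' [<- <- l]]]]; [by left|right].
by apply/existsP; exists b; apply/existsP; exists b'; rewrite !eqxx.
Qed.

Lemma overlap_row_linked i j : is_skew_shape mu nu -> (i <= j)%N ->
  (forall k, i <= k < j -> part nu k < part mu k.+1)%N ->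
  row_linked i j && row_linked j i.
Proof.
move=> sk; rewrite leq_eqVlt => /predU1P[-> _|lt ov].
  by rewrite /row_linked eqxx.
have [pmu pnu _] := sk.
have [b rb _] : exists2 b : box mu nu, brow b = i & bcol b = part nu i.
  apply: box_exists; rewrite leqnn (leq_trans (ov i _)) ?leqnn //.
  exact: part_anti.
have [b' rb' _] : exists2 b : box mu nu, brow b = j & bcol b = part nu j.
  apply: box_exists; rewrite leqnn; case: j lt ov => // j lt ov.
  by rewrite (leq_ltn_trans (part_anti pnu (leqnSn j))) // ov // ltnSn andbT.
have l : linked b b' by apply: overlap_linked; rewrite ?rb ?rb' // ltnW.
apply/andP; split; apply/row_linkedP; right; first by exists b, b'.
by exists b', b; rewrite linkedC.
Qed.

End Components.

(** * The block structure of the Jacobi-Trudi exponents *)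

Definition jt_exp n mu nu (i j : 'I_n) : int := add_delta mu i - add_delta nu j.

Lemma jt_exp_neg n mu nu (i j : 'I_n) (k : nat) : is_skew_shape mu nu ->
  (part mu k.+1 <= part nu k)%N -> (j <= k < i)%N -> jt_exp mu nu i j < 0.
Proof.
case=> pmu pnu _ gap /andP[jk ki]; rewrite /jt_exp /add_delta.
have := part_anti pmu ki; have := part_anti pnu jk.
by have := ltn_ord i; lia.
Qed.

(** A gap between rows [k] and [k.+1] makes the matrix of exponents negative
    below a block diagonal. A permutation that avoids the negative entries
    maps the rows after the gap to themselves, hence also those before it. *)
Lemma jt_exp_ge0_linked n mu nu (w : 'S_n) : is_skew_shape mu nu ->
  (forall i, 0 <= jt_exp mu nu i (w i)) ->
  forall i : 'I_n, row_linked mu nu i (w i).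
Proof.
move=> sk ge0 i.
have sep k : (part mu k.+1 <= part nu k)%N ->
    forall i : 'I_n, (k < w i)%N = (k < i)%N.
  move=> gap; pose A := [set i : 'I_n | (k < i)%N].
  have sub : w @: A \subset A.
    apply/subsetP => x /imsetP[j jA ->]; move: jA; rewrite !inE => kj.
    rewrite ltnNge; apply/negP => wk.
    by have := ge0 j; rewrite leNgt (jt_exp_neg sk gap) // wk.
  have wA : w @: A = A.
    by apply/eqP; rewrite eqEcard sub (card_imset _ (@perm_inj _ w)) leqnn.
  by move=> j; have := mem_imset A j (@perm_inj _ w); rewrite wA !inE.
have ov k : (minn i (w i) <= k < maxn i (w i) -> part nu k < part mu k.+1)%N.
  by move=> hk; rewrite ltnNge; apply/negP => gap; have := sep k gap i; lia.
have mM : (minn i (w i) <= maxn i (w i))%N by rewrite geq_min !leq_max leqnn.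
have /andP[] := overlap_row_linked sk mM ov.
by case: (leqP i (w i)).
Qed.

(** * Matching the rows of two diagrams with identical components *)

(** The complements of [A] and [B] have the same cardinality, so they can be
    matched through their enumerations. *)
Lemma perm_extend (T : finType) (A B : {set T}) (g : T -> T) :
  {in A &, injective g} -> g @: A = B -> exists s : {perm T}, {in A, s =1 g}.
Proof.
move=> gi gA.
have cAB : #|~: A| = #|~: B|.
  by have := card_in_imset gi; rewrite gA; have := cardsC A; have := cardsC B; lia.
pose h x := if x \in A then g x
            else nth x (enum (~: B)) (index x (enum (~: A))).
have hC x : x \notin A -> (index x (enum (~: A)) < size (enum (~: B)))%N.
  by move=> xA; rewrite -cardE -cAB cardE index_mem mem_enum inE.
have hB x : (h x \in B) = (x \in A).
  rewrite /h; case: ifPn => xA; first by rewrite -gA imset_f.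
  by have := mem_nth x (hC x xA); rewrite mem_enum inE => /negbTE.
have hi : injective h.
  move=> x y e; have := hB x; rewrite e hB; move: e; rewrite /h.
  case: ifPn => yA; case: ifPn => xA // e _; first exact: gi.
  move/eqP: e; rewrite (set_nth_default x) ?hC // nth_uniq ?hC ?enum_uniq //.
  move/eqP/(congr1 (nth x (enum (~: A)))).
  by rewrite !nth_index // mem_enum inE.
by exists (perm hi) => x xA; rewrite permE /h xA.
Qed.

Section Matching.

Variables (n : nat) (mu0 nu0 mu1 nu1 : seq nat).
Hypotheses (skew0 : is_skew_shape mu0 nu0) (skew1 : is_skew_shape mu1 nu1).
Hypotheses (len0 : (skew_length mu0 nu0 <= n)%N)
           (len1 : (skew_length mu1 nu1 <= n)%N).

(** Both ends of a row are determined by its component, so that the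
    translation carrying a component to its image also carries the ends of its
    rows to the ends of the image rows. *)
Lemma translate_row (b : box mu0 nu0) (c : box mu1 nu1) (d : int * int) :
  [seq val x + d | x in comp b] =i [seq val x | x in comp c] ->
  exists2 c' : box mu1 nu1, comp c' = comp c &
  [/\ (brow c')%:Z = (brow b)%:Z + d.1,
      (part mu1 (brow c'))%:Z = (part mu0 (brow b))%:Z + d.2 &
      (part nu1 (brow c'))%:Z = (part nu0 (brow b))%:Z + d.2].
Proof.
move=> tr.
have fwd x : x \in comp b -> exists2 y, y \in comp c &
    (brow y)%:Z = (brow x)%:Z + d.1 /\ (bcol y)%:Z = (bcol x)%:Z + d.2.
  move=> xb; have /imageP[y yc e] : val x + d \in [seq val y | y in comp c].
    by rewrite -tr; apply/imageP; exists x.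
  by exists y => //; move: e; rewrite !box_val; case: d {tr} => d1 d2 [-> ->].
have bwd y : y \in comp c -> exists2 x, x \in comp b &
    (brow y)%:Z = (brow x)%:Z + d.1 /\ (bcol y)%:Z = (bcol x)%:Z + d.2.
  move=> yc; have /imageP[x xb e] : val y \in [seq val x + d | x in comp b].
    by rewrite tr; apply/imageP; exists y.
  by exists x => //; move: e; rewrite !box_val; case: d {tr fwd} => d1 d2 [-> ->].
have [c' c'c [rc _]] := fwd b (comp_refl b).
have ec : comp c' = comp c by apply/esym/comp_eq; move: c'c; rewrite inE.
exists c' => //; split=> //.
(* Row [b] and row [c'] agree after shifting the columns by [d.2]; this is
   then used at the two ends of each row. *)
all: have fw j : (part nu0 (brow b) <= j < part mu0 (brow b))%N ->
  (part nu1 (brow c'))%:Z <= j%:Z + d.2 < (part mu1 (brow c'))%:Z.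
  1,3: move=> hj; have [x rx cx] := box_exists hj.
  1,2: have [|y yc [ry cy]] := fwd x.
  1,3: by rewrite inE same_row_linked.
  1,2: have ryc : brow y = brow c' by lia.
  1,2: by have := box_in y; rewrite ryc; lia.
all: have bw j : (part nu1 (brow c') <= j < part mu1 (brow c'))%N ->
  (part nu0 (brow b))%:Z <= j%:Z - d.2 < (part mu0 (brow b))%:Z.
  1,3: move=> hj; have [y ry cy] := box_exists hj.
  1,2: have [|x xb [rx cx]] := bwd y.
  1,3: by rewrite -ec inE same_row_linked.
  1,2: have rxb : brow x = brow b by lia.
  1,2: by have := box_in x; rewrite rxb; lia.
all: have h0 := box_in b; have h1 := box_in c'.
all: have f1 := fw (part nu0 (brow b)); have f2 := fw (part mu0 (brow b)).-1.
all: have b1 := bw (part nu1 (brow c')); have b2 := bw (part mu1 (brow c')).-1.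
all: by lia.
Qed.

Hypothesis same : identical_components mu0 nu0 mu1 nu1.

(** Each nonempty row moves along with its component; the empty rows are
    matched arbitrarily. *)
Lemma row_matching : exists s : 'S_n,
  (forall i j : 'I_n, row_linked mu0 nu0 i j ->
     jt_exp mu1 nu1 (s i) (s j) = jt_exp mu0 nu0 i j) /\
  (forall i j : 'I_n, row_linked mu1 nu1 (s i) (s j) -> row_linked mu0 nu0 i j).
Proof.
have [f [finj fim ftr]] := same.
(* One translation per component, so that rows of the same component are moved
   by the same vector. *)
have [d dP] : exists d : {set box mu0 nu0} -> int * int,
    forall C, C \in components mu0 nu0 ->
      [seq val x + d C | x in C] =i [seq val x | x in f C].
  apply: (fin_all_exists (P := fun C e => C \in components mu0 nu0 ->
    [seq val x + e | x in C] =i [seq val x | x in f C])) => C.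
  case: (boolP (C \in components mu0 nu0)) => [/ftr[e he]|]; first by exists e.
  by exists 0.
have brow_n0 (b : box mu0 nu0) : (brow b < n)%N.
  exact: leq_trans (brow_lt_skew_length b) len0.
have brow_n1 (c : box mu1 nu1) : (brow c < n)%N.
  exact: leq_trans (brow_lt_skew_length c) len1.
have fcomp b : exists c, f (comp b) = comp c.
  by apply: componentsP; rewrite -fim imset_f ?comp_in.
have rows b : exists2 c : box mu1 nu1, f (comp b) = comp c &
  [/\ (brow c)%:Z = (brow b)%:Z + (d (comp b)).1,
      (part mu1 (brow c))%:Z = (part mu0 (brow b))%:Z + (d (comp b)).2 &
      (part nu1 (brow c))%:Z = (part nu0 (brow b))%:Z + (d (comp b)).2].
  have [c fc] := fcomp b; have := dP _ (comp_in b); rewrite fc.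
  by case/translate_row=> c' e h; exists c' => //; rewrite e.
pose moves (i i' : 'I_n) := forall b, brow b = i ->
  exists2 c : box mu1 nu1, f (comp b) = comp c &
  [/\ brow c = i', (brow c)%:Z = (brow b)%:Z + (d (comp b)).1,
      (part mu1 (brow c))%:Z = (part mu0 (brow b))%:Z + (d (comp b)).2 &
      (part nu1 (brow c))%:Z = (part nu0 (brow b))%:Z + (d (comp b)).2].
have [g gP] : exists g : 'I_n -> 'I_n, forall i, moves i (g i).
  apply: fin_all_exists => i.
  case: (ltnP (part nu0 i) (part mu0 i)) => [/nonempty_row[b rb]|le].
    have [c fc [rc h1 h2]] := rows b; exists (Ordinal (brow_n1 c)) => b' rb'.
    have e : comp b' = comp b by apply/comp_eq/same_row_linked; rewrite rb'.
    by exists c; rewrite ?e // rb' -rb.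
  exists i => b rb; have : (part nu0 i < part mu0 i)%N.
    by apply/nonempty_row; exists b.
  by rewrite ltnNge le.
pose A0 := [set i : 'I_n | (part nu0 i < part mu0 i)%N].
pose A1 := [set i : 'I_n | (part nu1 i < part mu1 i)%N].
have A0P i : i \in A0 -> exists b : box mu0 nu0, brow b = i.
  by rewrite inE => /nonempty_row.
have comp_f_inj b b' : f (comp b) = f (comp b') -> comp b = comp b'.
  by apply: finj; apply: comp_in.
have ginj : {in A0 &, injective g}.
  move=> i j /A0P[b rb] /A0P[b' rb'] e.
  have [c fc [gc rc _ _]] := gP i b rb; have [c' fc' [gc' rc' _ _]] := gP j b' rb'.
  have ebb : comp b = comp b'.
    apply: comp_f_inj; rewrite fc fc'; apply/comp_eq/same_row_linked.
    by rewrite gc gc' e.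
  have ecc : brow c = brow c' by rewrite gc gc' e.
  by apply: val_inj; rewrite /= -rb -rb'; move: rc rc'; rewrite ecc ebb; lia.
have gA : g @: A0 = A1.
  apply/setP => i; apply/imsetP/idP => [[j /A0P[b rb] ->]|].
    have [c _ [gc _ _ _]] := gP j b rb.
    by rewrite inE -gc; apply/nonempty_row; exists c.
  rewrite inE => /nonempty_row[c rc].
  have /imsetP[C Cin fC] : comp c \in f @: components mu0 nu0.
    by rewrite fim comp_in.
  have /imageP[b bC e] : val c \in [seq val x + d C | x in C].
    by rewrite dP // -fC; apply/imageP; exists c => //; apply: comp_refl.
  have eC : C = comp b.
    by have [b0 e0] := componentsP Cin; move: bC; rewrite e0 inE => /comp_eq.
  exists (Ordinal (brow_n0 b)).
    by rewrite inE; apply/nonempty_row; exists b.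
  have [c' _ [gc' rc' _ _]] := gP (Ordinal (brow_n0 b)) b erefl.
  apply: val_inj; rewrite /= -gc' -rc; move: e; rewrite !box_val eC => -[e _].
  by move: rc'; rewrite -e => -[].
have [s sg] := perm_extend ginj gA.
have sA i : (s i \in A1) = (i \in A0).
  apply/idP/idP => [|iA]; last by rewrite sg // -gA imset_f.
  by rewrite -gA => /imsetP[j jA]; rewrite -sg // => /perm_inj ->.
exists s; split=> i j.
  (* On nonempty rows the translation adds [d.2 - d.1] to both terms of the
     difference. *)
  case/row_linkedP=> [/val_inj <-|[b [b' [rb rb' l]]]].
    case: (boolP (i \in A0)) => [iA|iA].
      have [b rb] := A0P _ iA; have [c _ [gc rc hm hn]] := gP i b rb.
      rewrite sg // /jt_exp /add_delta -gc -rb; lia.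
    have := sA i; rewrite (negbTE iA) => /negbT siA; move: iA siA.
    rewrite !inE -!leqNgt => le0 le1.
    have [_ _ /(_ i) ge0] := skew0; have [_ _ /(_ (s i)) ge1] := skew1.
    have e0 : part nu0 i = part mu0 i by apply/eqP; rewrite eqn_leq ge0.
    have e1 : part nu1 (s i) = part mu1 (s i) by apply/eqP; rewrite eqn_leq ge1.
    by rewrite /jt_exp /add_delta e0 e1 !subrr.
  have iA : i \in A0 by rewrite inE; apply/nonempty_row; exists b.
  have jA : j \in A0 by rewrite inE; apply/nonempty_row; exists b'.
  have [c _ [gc rc hm _]] := gP i b rb; have [c' _ [gc' rc' _ hn']] := gP j b' rb'.
  have hi := ltn_ord i; have hj := ltn_ord j.
  have hci := ltn_ord (g i); have hcj := ltn_ord (g j).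
  rewrite !sg // /jt_exp /add_delta -gc -gc' -rb -rb'.
  move: rc hm rc' hn'; rewrite (comp_eq l); lia.
case/row_linkedP=> [/val_inj/perm_inj ->|[c [c' [rc rc' l]]]].
  by apply/row_linkedP; left.
have iA : i \in A0 by rewrite -sA inE; apply/nonempty_row; exists c.
have jA : j \in A0 by rewrite -sA inE; apply/nonempty_row; exists c'.
have [b rb] := A0P _ iA; have [b' rb'] := A0P _ jA.
have [ci fci [gci _ _ _]] := gP i b rb; have [cj fcj [gcj _ _ _]] := gP j b' rb'.
apply/row_linkedP; right; exists b, b'; split=> //.
suff e : comp b = comp b' by have := comp_refl b'; rewrite -e inE.
apply: comp_f_inj; rewrite fci fcj; apply/comp_eq.
apply: (connect_trans (_ : connect _ ci c)); first by
  apply: same_row_linked; rewrite rc gci -sg.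
by apply: (connect_trans l); apply: same_row_linked; rewrite rc' gcj -sg.
Qed.

End Matching.

(** * Equality of the immanant characters *)

(** If [w^-1] preserves the blocks, conjugation by the row matching permutes
    the content. If not, it still does not preserve them after conjugation, and
    both contents have a negative entry. *)
Lemma kostka_conj n mu0 nu0 mu1 nu1 theta (s w : 'S_n) :
  is_partition theta -> is_skew_shape mu0 nu0 -> is_skew_shape mu1 nu1 ->
  (forall i j : 'I_n, row_linked mu0 nu0 i j ->
     jt_exp mu1 nu1 (s i) (s j) = jt_exp mu0 nu0 i j) ->
  (forall i j : 'I_n, row_linked mu1 nu1 (s i) (s j) -> row_linked mu0 nu0 i j) ->
  kostka theta (fun i => jt_exp mu0 nu0 i ((w^-1)%g i)) =
  kostka theta (fun i => jt_exp mu1 nu1 i (((w ^ s)^-1)%g i)).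
Proof.
move=> tp sk0 sk1 sE sL; rewrite -(kostka_perm tp s (fun i => jt_exp mu1 _ _ _)).
have wsE i : ((w ^ s)^-1)%g (s i) = s ((w^-1)%g i) by rewrite -conjVg permJ.
case: (boolP [forall i : 'I_n, row_linked mu0 nu0 i ((w^-1)%g i)]).
  by move/forallP=> l; apply: kostka_ext => i /=; rewrite wsE sE.
move=> /forallP nl.
have zero (c : 'I_n -> int) : ~ (forall i, 0 <= c i) -> kostka theta c = 0%N.
  move=> nc; case: (boolP [forall i, 0 <= c i]) => [/forallP//|].
  by case/forallPn=> i; rewrite -ltNge; apply: kostka_neg.
rewrite !zero // => ge0; apply: nl => i; last exact: jt_exp_ge0_linked.
apply: sL; rewrite -wsE; apply: jt_exp_ge0_linked => // j.
by have := ge0 ((s^-1)%g j); rewrite /= permKV.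
Qed.

Theorem proposition3p3 (n : nat) (mu0 nu0 mu1 nu1 theta : seq nat)
    (hskew0 : is_skew_shape mu0 nu0) (hskew1 : is_skew_shape mu1 nu1)
    (hlen0 : (skew_length mu0 nu0 <= n)%N) (hlen1 : (skew_length mu1 nu1 <= n)%N)
    (hcomp : identical_components mu0 nu0 mu1 nu1)
    (htheta : is_partition theta) (hsize : sumn theta = skew_size mu0 nu0) :
  @immanant_character n theta mu0 nu0 =1 @immanant_character n theta mu1 nu1.
Proof.
move=> w; rewrite /immanant_character; congr (_ * _).
have [s [sE sL]] := row_matching hskew0 hskew1 hlen0 hlen1 hcomp.
rewrite [RHS](reindex_inj (conjg_inj s)) /=; apply: eq_big => [w'|w' _].
  by rewrite (class_transl _ (memJ_class _ (in_setT s))).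
by congr (_%:Z); apply: (kostka_conj _ htheta hskew0 hskew1 sE sL).
Qed.
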